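(* Let $G=(V,E)$ be a multi-block graph with blocks $G_t$, $1\leq t\leq b$. If $\operatorname{cof} D(G_t)\neq 0$ for all $1\leq t\leq b$, then the determinant of $D(G)$ is given by $$\det D(G)= \lambda_G \prod_{t=1}^b \operatorname{cof} D(G_t) = \lambda_G \, \operatorname{cof} D(G).$$
   Context: All graphs are finite, simple and connected. A block of a graph is a maximal connected subgraph that has no cut-vertex (of itself). For $m\ge 2$, a complete $m$-partite graph has vertex set partitioned into $m$ nonempty parts, two vertices being adjacent if and only if they lie in different parts. A connected graph is a multi-block graph if each of its blocks is a complete $m$-partite graph for some $m\ge 2$ (which may depend on the block). $D(G)$ is the distance matrix of $G$ (entries are graph distances). For a square matrix $B$, $\operatorname{cof} B$ is the sum of all cofactors of $B$. For each block $G_t$ with $\operatorname{cof} D(G_t)\ne 0$, $\lambda_{G_t}=\dfrac{\det D(G_t)}{\operatorname{cof} D(G_t)}$, and $\lambda_G=\sum_{t=1}^b\lambda_{G_t}$. *)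

(* Defs.v *)
From HB Require Import structures.
From mathcomp Require Import all_boot all_order all_algebra.

Set Implicit Arguments.
Unset Strict Implicit.
Unset Printing Implicit Defensive.

Import GRing.Theory.
Local Open Scope ring_scope.

(* A finite simple graph (V, E) with V a subset of T: an edge is an unordered
   pair of distinct vertices, so that adjacency is symmetric and irreflexive.
   V need not be all of T, which makes subgraphs graphs over the same T. *)
Definition is_graph (T : finType) (VE : {set T} * {set {set T}}) : bool :=
  [forall a in VE.2, (#|a| == 2) && (a \subset VE.1)].

Record graph (T : finType) := Graph {
  graph_val : {set T} * {set {set T}};
  _ : is_graph graph_val }.

HB.instance Definition _ (T : finType) := [isSub for @graph_val T].
HB.instance Definition _ (T : finType) := [Finite of graph T by <:].

Section Graphs.

Variable T : finType.
Implicit Types (G H B : graph T) (x y v : T).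

Definition vertices G : {set T} := (graph_val G).1.
Definition edges G : {set {set T}} := (graph_val G).2.

Definition adj G : rel T := fun x y => [set x; y] \in edges G.

Definition subgraph H G : bool :=
  (vertices H \subset vertices G) && (edges H \subset edges G).

(* The graph without vertices is not connected. *)
Definition connected G : bool :=
  (vertices G != set0) &&
  [forall x in vertices G, forall y in vertices G, connect (adj G) x y].

(* Adjacency in G - v. *)
Definition adj_del G v : rel T :=
  fun x y => [&& x != v, y != v & adj G x y].

(* v separates two other vertices of the same component of G; in particular
   the vertex of K_1 and those of K_2 are not cut-vertices. *)
Definition cut_vertex G v : bool :=
  (v \in vertices G) &&
  [exists x in vertices G :\ v, exists y in vertices G :\ v,
     connect (adj G) x y && ~~ connect (adj_del G v) x y].

Definition nonseparable G : bool :=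
  connected G && [forall v, ~~ cut_vertex G v].

(* Maximality is among all subgraphs, not only the induced ones. *)
Definition is_block G B : bool :=
  [&& subgraph B G, nonseparable B &
      [forall H, [&& subgraph H G, nonseparable H & subgraph B H] ==>
                 (H == B)]].

Definition blocks G : {set graph T} := [set B | is_block G B].

(* The members of a partition are nonempty by definition. *)
Definition complete_multipartite (m : nat) G : Prop :=
  exists P : {set {set T}},
    [/\ partition P (vertices G), #|P| = m
      & {in vertices G &, forall x y,
           adj G x y = (pblock P x != pblock P y)}].

Definition multi_block G : Prop :=
  connected G /\
  forall B, B \in blocks G ->
    exists2 m : nat, (2 <= m)%N & complete_multipartite m B.

Definition has_walk G (k : nat) x y : bool :=
  [exists p : k.-tuple T, path (adj G) x p && (last x p == y)].

(* The least length of a walk from x to y. Vertices in the same component are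
   joined by a walk of length < #|T|; the value is #|T| if there is none. *)
Definition dist G x y : nat :=
  find (fun k => has_walk G k x y) (iota 0 #|T|).

Definition dist_mx G : 'M[rat]_#|vertices G| :=
  \matrix_(i, j) (dist G (enum_val i) (enum_val j))%:R.

End Graphs.

Definition cof (R : comNzRingType) (n : nat) (A : 'M[R]_n) : R :=
  \sum_(i < n) \sum_(j < n) cofactor A i j.

Definition lambda_block (T : finType) (B : graph T) : rat :=
  \det (dist_mx B) / cof (dist_mx B).

Definition lambda_graph (T : finType) (G : graph T) : rat :=
  \sum_(B in blocks G) lambda_block B.

(* Main.v *)
Require Import Defs.
From HB Require Import structures.
From mathcomp Require Import all_boot all_order all_algebra.
From mathcomp Require Import perm zify ring.

Set Implicit Arguments.
Unset Strict Implicit.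
Unset Printing Implicit Defensive.

Import GRing.Theory.
Local Open Scope ring_scope.

(** The blocks of a graph are glued together one at a time along cut-vertices,
    and the pair (det D, cof D) behaves well under one such gluing; the theorem
    follows by induction on the number of vertices.

    The linear algebra.  Let J be the all-ones matrix.  Expanding a bordered
    determinant shows that det (A + J) = det A + cof A (det_add_const1), so cof
    can be computed with determinants only.  Fix a vertex v and subtract the
    row of v from the other rows, then the column of v from the other columns.
    This preserves determinants, and replacing D by D + J then changes only the
    entry at (v, v), by 1.  Hence cof D is the determinant of the reduced matrix
    with v deleted (set_cof_reduce), whose entries are
    d(x, y) - d(x, v) - d(v, y) since d(v, v) = 0.  Such an entry vanishes when
    v lies between x and y.  So if V = V1 U V2 where V1 and V2 meet only in a
    cut-vertex v that separates them, the reduced matrix without v is block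
    diagonal, and cof D = cof D1 * cof D2.  With the row and column of v kept,
    writing the row of v as the sum of its V1-part and its V2-part gives
    det D = det D1 * cof D2 + cof D1 * det D2 (set_det_glue).  In other words
    cof is multiplicative and det / cof, where defined, is additive.

    The graph theory.  A connected graph that is not its own single block has a
    cut-vertex v and splits into two smaller induced subgraphs as above
    (exists_separation).  Collapsing one side to v turns walks of the graph into
    walks of the other side that are not longer (retract_walk); it follows that
    both sides are connected, that their distances are those of the graph, and
    that distances across v add up (dist_part, dist_through).  Finally a
    nonseparable subgraph cannot extend to both sides of v, so the blocks of the
    graph are those of the two sides, without repetition (blocks_separation). *)

(** * Cofactor sums as determinants *)

(** Both sides are determinants of A bordered by a row of 1s and a column of
    -1s: with corner 1, elimination gives det (A + J); with corner 0, expansion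
    along the border gives cof A; and the determinant is affine in the corner
    with slope det A. *)
Lemma det_add_const1 (R : comNzRingType) n (A : 'M[R]_n) :
  \det (A + const_mx 1) = \det A + cof A.
Proof.
case: n A => [|n] A.
  by rewrite /cof big_ord0 addr0 [A + _]flatmx0 [A]flatmx0.
pose M (c : R) : 'M[R]_(1 + n.+1) :=
  block_mx c%:M (const_mx 1) (const_mx (- 1)) A.
have M1 : \det (M 1) = \det (A + const_mx 1).
  have <- : block_mx 1%:M 0 (const_mx (-1)) 1%:M *m
            block_mx 1%:M (const_mx 1) 0 (A + const_mx 1) = M 1.
    rewrite mulmx_block !mul1mx !mul0mx !mulmx1 !addr0.
    congr block_mx; apply/matrixP => i j.
    rewrite !mxE big_ord1 !mxE; ring.
  by rewrite det_mulmx det_lblock det_ublock !det1 !mul1r.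
have M0 : \det (M 0) = cof A.
  rewrite (expand_det_row _ ord0) big_ord_recl.
  have -> : M 0 ord0 ord0 = 0.
    transitivity (M 0 (lshift _ ord0) (lshift _ ord0)).
      by congr (M 0 _ _); apply: val_inj.
    by rewrite block_mxEul mxE.
  rewrite mul0r add0r /cof exchange_big; apply: eq_bigr => j _ /=.
  have -> : M 0 ord0 (lift ord0 j) = 1.
    transitivity (M 0 (lshift _ ord0) (rshift 1 j)).
      by congr (M 0 _ _); apply: val_inj.
    by rewrite block_mxEur mxE.
  rewrite mul1r /cofactor (expand_det_col _ ord0) big_distrr /=.
  apply: eq_bigr => i _; rewrite [X in _ * (X * _)]mxE [X in _ * (X * _)]mxE.
  have -> : M 0 (lift ord0 i) (lift (lift ord0 j) ord0) = -1.
    transitivity (M 0 (rshift 1 i) (lshift _ ord0)).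
      by congr (M 0 _ _); apply: val_inj.
    by rewrite block_mxEdl mxE.
  rewrite /cofactor.
  rewrite (_ : row' i (col' ord0 (row' ord0 (col' (lift ord0 j) (M 0)))) =
               row' i (col' j A)).
    rewrite /= add0n addn0 /bump /= add1n exprS exprD; ring.
  (* Deleting the border together with row i and column j leaves a minor of A. *)
  apply/matrixP => k l; do 4!rewrite [LHS]mxE; do 2!rewrite [RHS]mxE.
  transitivity (M 0 (rshift 1 (lift i k)) (rshift 1 (lift j l))).
    congr (M 0 _ _); apply: val_inj; rewrite /= /bump /=; lia.
  by rewrite block_mxEdr.
rewrite -M1 -M0.
rewrite (@determinant_multilinear _ _ (M 1)
  (block_mx 1%:M 0 (const_mx (- 1)) A) (M 0) (lshift _ ord0) 1 1).
- by rewrite det_lblock det1 !mul1r.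
- rewrite !scale1r; apply/rowP => j.
  rewrite [LHS]mxE [RHS]mxE [X in X + _]mxE [X in _ + X]mxE.
  rewrite -[j]splitK; case: (split j) => k /=.
    by rewrite !block_mxEul !mxE [k]ord1 addr0.
  by rewrite !block_mxEur !mxE add0r.
all: apply/matrixP => i j; rewrite [LHS]mxE [RHS]mxE.
all: rewrite (_ : lift _ i = rshift 1 i); last exact: val_inj.
all: rewrite -[j]splitK; case: (split j) => k /=.
all: by rewrite ?block_mxEdl ?block_mxEdr.
Qed.

(** * Determinants indexed by a set of labels *)

Section SetDeterminant.

Variables (R : comNzRingType) (T : finType).
Implicit Types (A B S W : {set T}) (f g h : T -> T -> R) (v x y : T).

(** Matrices are handled as functions on labels restricted to finite sets, so
    that sets can be cut and merged without any renumbering. *)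
Definition gram A B f : 'M[R]_(#|A|, #|B|) :=
  \matrix_(i, j) f (enum_val i) (enum_val j).

Definition set_det S f : R := \det (gram S S f).

Definition set_cof S f : R := cof (gram S S f).

Lemma eq_set_det S f g :
  {in S &, forall x y, f x y = g x y} -> set_det S f = set_det S g.
Proof.
move=> fg; congr (\det _); apply/matrixP => i j.
by rewrite !mxE fg ?enum_valP.
Qed.

(** Changing the numbering of the labels permutes rows and columns in the same
    way, and the two signs cancel. *)
Lemma det_enum n (e : 'I_n -> T) S f :
    injective e -> codom e =i S ->
  \det (\matrix_(i, j) f (e i) (e j)) = set_det S f.
Proof.
move=> e_inj eS.
have En : #|S| = n by rewrite -(eq_card eS) card_codom // card_ord.
subst n.
have e_in i : e i \in S by rewrite -eS codom_f.
pose s i := enum_rank_in (e_in i) (e i).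
have sK i : enum_val (s i) = e i by rewrite enum_rankK_in.
have s_inj : injective s by move=> i j /(congr1 enum_val); rewrite !sK => /e_inj.
rewrite (_ : \matrix_(_, _) _ =
             row_perm (perm s_inj) (col_perm (perm s_inj) (gram S S f))).
  rewrite row_permE col_permE !det_mulmx !det_perm mulrC -mulrA -signr_addb.
  by rewrite odd_permV addbb mulr1.
by apply/matrixP => i j; rewrite !mxE !permE !sK.
Qed.

Lemma set_det_block A B f : [disjoint A & B] ->
  set_det (A :|: B) f =
  \det (block_mx (gram A A f) (gram A B f) (gram B A f) (gram B B f)).
Proof.
move=> dAB.
pose e (i : 'I_(#|A| + #|B|)) : T :=
  match split i with inl k => enum_val k | inr k => enum_val k end.
rewrite -(@det_enum _ e); first last.
- move=> x; rewrite inE; apply/codomP/orP => [[i ->]|[xA|xB]].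
  + by rewrite /e; case: (split i) => k; [left|right]; apply: enum_valP.
  + by exists (unsplit (inl (enum_rank_in xA x))); rewrite /e unsplitK enum_rankK_in.
  + by exists (unsplit (inr (enum_rank_in xB x))); rewrite /e unsplitK enum_rankK_in.
- move=> i j eij; rewrite -[i]splitK -[j]splitK; move: eij; rewrite /e.
  case: (split i) (split j) => k [] l.
  + by move/enum_val_inj ->.
  + by move=> E; have := disjointFr dAB (enum_valP k); rewrite E enum_valP.
  + by move=> E; have := disjointFl dAB (enum_valP k); rewrite E enum_valP.
  + by move/enum_val_inj ->.
congr (\det _); apply/matrixP => i j; rewrite mxE /e.
rewrite -{2}[i]splitK -{2}[j]splitK; case: (split i) (split j) => k [] l /=.
- by rewrite block_mxEul mxE.
- by rewrite block_mxEur mxE.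
- by rewrite block_mxEdl mxE.
- by rewrite block_mxEdr mxE.
Qed.

Lemma set_det_lblock A B f : [disjoint A & B] ->
    {in A & B, forall x y, f x y = 0} ->
  set_det (A :|: B) f = set_det A f * set_det B f.
Proof.
move=> dAB f0; rewrite set_det_block // [gram A B f](_ : _ = 0) ?det_lblock //.
by apply/matrixP => i j; rewrite !mxE f0 ?enum_valP.
Qed.

Lemma set_det1 v f : set_det [set v] f = f v v.
Proof.
rewrite /set_det [gram _ _ f](_ : _ = (f v v)%:M) ?det_scalar ?cards1 ?expr1 //.
apply/matrixP => i j; rewrite !mxE.
have := enum_valP i; have := enum_valP j; rewrite !inE => /eqP Ej /eqP Ei.
by rewrite Ei Ej (_ : i = j) ?eqxx //; apply: enum_val_inj; rewrite Ei Ej.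
Qed.

Lemma set_det_row_add S v f g h : v \in S ->
    {in S, forall y, f v y = g v y + h v y} ->
    {in S :\ v & S, forall x y, g x y = f x y /\ h x y = f x y} ->
  set_det S f = set_det S g + set_det S h.
Proof.
move=> vS fv fgh; pose i0 := enum_rank_in vS v.
have other i : enum_val (lift i0 i) \in S :\ v.
  rewrite 2!inE enum_valP andbT; apply: contraTneq (neq_lift i0 i) => Ev.
  by rewrite negbK; apply/eqP/enum_val_inj; rewrite enum_rankK_in.
rewrite /set_det (@determinant_multilinear _ _ _ (gram S S g) (gram S S h) i0 1 1).
- by rewrite !mul1r.
- by rewrite !scale1r; apply/rowP => j; rewrite !mxE enum_rankK_in // fv ?enum_valP.
- by apply/matrixP => i j; rewrite !mxE; case: (fgh _ _ (other i) (enum_valP j)).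
- by apply/matrixP => i j; rewrite !mxE; case: (fgh _ _ (other i) (enum_valP j)).
Qed.

(** The row of v is subtracted from all other rows, and then the column of v from
    all other columns.  The row and the column of v themselves are not
    subtracted, which accounts for the cases. *)
Definition reduce v f x y : R :=
  f x y - (if x == v then 0 else f v y) - (if y == v then 0 else f x v)
        + (if (x == v) || (y == v) then 0 else f v v).

(** The reduction amounts to multiplying by unitriangular matrices on both
    sides. *)
Lemma set_det_reduce S v f : v \in S -> set_det S f = set_det S (reduce v f).
Proof.
move=> vS; pose W := S :\ v.
have dvW : [disjoint [set v] & W] by rewrite disjoints1 !inE eqxx.
have v1 (i : 'I_#|[set v]|) : enum_val i = v.
  by apply/eqP; have := enum_valP i; rewrite inE.
have vN (i : 'I_#|W|) : (enum_val i == v) = false.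
  by apply/negbTE; have := enum_valP i; rewrite !inE => /andP[].
rewrite -(setD1K vS) !set_det_block //.
have -> : block_mx (gram [set v] [set v] f) (gram [set v] W f)
                   (gram W [set v] f) (gram W W f) =
          block_mx 1%:M 0 (const_mx 1) 1%:M *m
          block_mx (gram [set v] [set v] (reduce v f)) (gram [set v] W (reduce v f))
                   (gram W [set v] (reduce v f)) (gram W W (reduce v f)) *m
          block_mx 1%:M (const_mx 1) 0 1%:M.
  rewrite !mulmx_block !mul1mx !mul0mx !mulmx1 !mulmx0 !addr0.
  have sum1 (F : 'I_#|[set v]| -> R) b : (forall i, F i = b) -> \sum_i F i = b.
    move=> Fb; rewrite (eq_bigr (fun=> b)) => [|i _]; last exact: Fb.
    by rewrite sumr_const card_ord cards1.
  congr block_mx; apply/matrixP => i j; rewrite !mxE ?v1 /reduce ?eqxx ?vN /=.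
  - ring.
  - rewrite (sum1 _ (f v v)); first ring.
    by move=> k; rewrite !mxE !v1 eqxx /=; ring.
  - rewrite (sum1 _ (f v v)); first ring.
    by move=> k; rewrite !mxE !v1 eqxx /=; ring.
  - rewrite (sum1 _ (f (enum_val i) v)); last first.
      move=> k; rewrite !mxE (sum1 _ (f v v)) ?v1 ?eqxx ?vN /=; first ring.
      by move=> l; rewrite !mxE !v1 eqxx /=; ring.
    rewrite (sum1 _ (f v (enum_val j) - f v v)); last first.
      by move=> k; rewrite !mxE !v1 eqxx vN /=; ring.
    ring.
by rewrite !det_mulmx det_lblock det_ublock !det1 !mul1r mulr1.
Qed.

Lemma set_det_add1 S f :
  set_det S (fun x y => f x y + 1) = set_det S f + set_cof S f.
Proof.
rewrite /set_det /set_cof -det_add_const1; congr (\det _).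
by apply/matrixP => i j; rewrite !mxE.
Qed.

(** Adding 1 to all entries of f adds 1 to the entry of its reduction at (v, v)
    and changes nothing else; the row of v is then split accordingly, the extra
    part having 1 at v as its only nonzero entry. *)
Lemma set_cof_reduce S v f :
  v \in S -> set_cof S f = set_det (S :\ v) (reduce v f).
Proof.
move=> vS; apply: (addrI (set_det S f)); rewrite -set_det_add1 addrC.
rewrite [LHS](set_det_reduce _ vS) (set_det_reduce f vS).
(* g has the extra part of the row of v, and the reduced entries elsewhere. *)
pose g x y := if x == v then (y == v)%:R else reduce v f x y.
rewrite (set_det_row_add (g := g) (h := reduce v f) vS).
- congr (_ + _); rewrite -{1}(setD1K vS) set_det_lblock.
  + rewrite set_det1 /g !eqxx mul1r; apply: eq_set_det => x y.
    by rewrite !inE => /andP[/negbTE ->].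
  + by rewrite disjoints1 !inE eqxx.
  + by move=> x y; rewrite !inE /g => -> /andP[/negbTE ->].
- by move=> y _; rewrite /g /reduce eqxx /=; case: eqP => [->|_]; rewrite /=; ring.
- move=> x y; rewrite !inE /g => /andP[/negbTE xv _] _.
  by rewrite /reduce xv /=; split=> //; case: eqP => [->|_]; rewrite /=; ring.
Qed.

(** Once the row of v is cut down to S1, all rows of S1 vanish on the rest of
    S2: the matrix is block triangular. *)
Lemma set_det_pruned_row S1 S2 v f : S1 :&: S2 = [set v] ->
    {in S1 :\ v & S2 :\ v, forall x y, f x y = 0} ->
  set_det (S1 :|: S2) (fun x y => if (x == v) && (y \notin S1) then 0 else f x y) =
  set_det S1 f * set_det (S2 :\ v) f.
Proof.
move=> S12 f0.
have vS1 : v \in S1 by have := set11 v; rewrite -S12 inE => /andP[].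
have onlyv x : x \in S1 -> x \in S2 -> x = v.
  by move=> x1 x2; apply/set1P; rewrite -S12 inE x1.
have -> : S1 :|: S2 = S1 :|: (S2 :\ v).
  by apply/setP => x; rewrite !inE; case: eqP => //= ->; rewrite vS1.
rewrite set_det_lblock.
- congr (_ * _); apply: eq_set_det => x y.
    by move=> _ ->; rewrite andbF.
  by rewrite !inE => /andP[/negbTE ->].
- rewrite -setI_eq0; apply/eqP/setP => x; rewrite !inE.
  by apply/negP => /andP[x1 /andP[/eqP xv x2]]; apply: xv; apply: onlyv.
- move=> x y x1 y2; have [yv yS2] := setD1P y2; case: eqP => /= [->|/eqP xv].
    by rewrite ifT //; apply: contraNN yv => y1; rewrite (onlyv _ y1 yS2).
  by rewrite f0 // !inE xv.
Qed.

(** The condition on f says that v lies between the two sides.  It makes the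
    reduced entries between S1 - v and S2 - v vanish. *)
Lemma set_det_glue S1 S2 v f :
    S1 :&: S2 = [set v] -> f v v = 0 ->
    {in S1 & S2, forall x y, f x y = f x v + f v y} ->
    {in S2 & S1, forall x y, f x y = f x v + f v y} ->
  set_cof (S1 :|: S2) f = set_cof S1 f * set_cof S2 f
  /\ set_det (S1 :|: S2) f =
       set_det S1 f * set_cof S2 f + set_cof S1 f * set_det S2 f.
Proof.
move=> S12 fvv f12 f21.
have /andP[vS1 vS2] : (v \in S1) && (v \in S2) by rewrite -in_setI S12 set11.
have vS : v \in S1 :|: S2 by rewrite inE vS1.
have reduce0 x y : x != v -> y != v -> f x y = f x v + f v y -> reduce v f x y = 0.
  by rewrite /reduce => /negbTE -> /negbTE -> -> /=; rewrite fvv; ring.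
have r12 : {in S1 :\ v & S2 :\ v, forall x y, reduce v f x y = 0}.
  by move=> x y /setD1P[xv x1] /setD1P[yv y2]; apply: reduce0 => //; apply: f12.
have r21 : {in S2 :\ v & S1 :\ v, forall x y, reduce v f x y = 0}.
  by move=> x y /setD1P[xv x2] /setD1P[yv y1]; apply: reduce0 => //; apply: f21.
have dW : [disjoint S1 :\ v & S2 :\ v].
  by rewrite -setI_eq0 -setDIl S12 setDv.
rewrite (set_cof_reduce f vS) (set_cof_reduce f vS1) (set_cof_reduce f vS2).
rewrite (set_det_reduce f vS) (set_det_reduce f vS1) (set_det_reduce f vS2).
split; first by rewrite setDUl set_det_lblock.
have rvv : reduce v f v v = 0 by rewrite /reduce eqxx fvv /=; ring.
(* The row of v is the sum of its restrictions to S1 and to S2; both contain v,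
   but the entry there is 0. *)
pose prune A x y := if (x == v) && (y \notin A) then 0 else reduce v f x y.
rewrite (set_det_row_add (g := prune S1) (h := prune S2) vS).
- rewrite /prune set_det_pruned_row // mulrC [set_det _ (reduce v f) * _]mulrC.
  by rewrite [S1 :|: S2]setUC set_det_pruned_row // 1?setIC // mulrC [X in _ + X]mulrC.
- move=> y; rewrite /prune eqxx inE /= => yS.
  have [->|yv] := eqVneq y v; first by rewrite vS1 vS2 /= rvv addr0.
  have [y1|y1] := boolP (y \in S1); last by rewrite /= add0r -[y \in S2]orFb -(negbTE y1) yS.
  rewrite ifT ?addr0 //=; apply: contraNN yv => y2.
  by apply/eqP/set1P; rewrite -S12 inE y1.
- by move=> x y /setD1P[/negbTE xv _] _; rewrite /prune xv.
Qed.

End SetDeterminant.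

(** * Subgraphs and distances *)

Section Graphs.

Variable T : finType.
Implicit Types (G H K : graph T) (A : {set T}) (x y z v : T) (p q : seq T).

Lemma edge_card G e : e \in edges G -> #|e| = 2.
Proof. by case: G => VE ok eVE; have /andP[/eqP] := forall_inP ok e eVE. Qed.

Lemma edge_sub G e : e \in edges G -> e \subset vertices G.
Proof. by case: G => VE ok eVE; have /andP[] := forall_inP ok e eVE. Qed.

Lemma graph_inj G H :
  vertices G = vertices H -> edges G = edges H -> G = H.
Proof.
case: G H => [[V E] hG] [[V' E'] hH]; rewrite /vertices /edges /= => EV EE.
by apply: val_inj; rewrite /= EV EE.
Qed.

Lemma adjC G x y : adj G x y = adj G y x.
Proof. by rewrite /adj setUC. Qed.

Lemma adj_vertices G x y : adj G x y -> (x \in vertices G) && (y \in vertices G).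
Proof. by move/edge_sub; rewrite subUset !sub1set. Qed.

Lemma adj_subgraph H G : subgraph H G -> subrel (adj H) (adj G).
Proof. by case/andP => _ /subsetP sub x y; apply: sub. Qed.

Lemma subgraph_trans : transitive (@subgraph T).
Proof.
move=> H K G /andP[v1 e1] /andP[v2 e2].
by rewrite /subgraph (subset_trans v1 v2) (subset_trans e1 e2).
Qed.

Lemma subgraph_refl : reflexive (@subgraph T).
Proof. by move=> G; rewrite /subgraph !subxx. Qed.

Lemma subgraph_anti : antisymmetric (@subgraph T).
Proof.
move=> G H /andP[/andP[v1 e1] /andP[v2 e2]].
by apply: graph_inj; apply/eqP; rewrite eqEsubset ?v1 ?e1.
Qed.

Fact induced_proof G A :
  is_graph (vertices G :&: A, [set e in edges G | e \subset A]).
Proof.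
apply/forall_inP => e; rewrite inE => /andP[eG eA].
by rewrite (edge_card eG) subsetI (edge_sub eG) eA.
Qed.

Definition induced G A : graph T := Graph (induced_proof G A).

Lemma induced_vertices G A : A \subset vertices G -> vertices (induced G A) = A.
Proof. by move/setIidPr. Qed.

Lemma induced_adj G A x y :
  adj (induced G A) x y = [&& adj G x y, x \in A & y \in A].
Proof. by rewrite /adj /edges /= inE subUset !sub1set. Qed.

Lemma induced_subgraph G A : subgraph (induced G A) G.
Proof.
rewrite /subgraph subsetIl; apply/subsetP => e.
by rewrite /edges /= inE => /andP[].
Qed.

Lemma subgraph_induced H G A :
  subgraph H G -> vertices H \subset A -> subgraph H (induced G A).
Proof.
move=> /andP[vHG eHG] vHA; rewrite /subgraph subsetI vHG vHA.
apply/subsetP => e eH; rewrite /edges inE /=.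
by rewrite (subsetP eHG e eH) (subset_trans (edge_sub eH) vHA).
Qed.

Lemma dist_le_walk G x p : path (adj G) x p -> (dist G x (last x p) <= size p)%N.
Proof.
move=> xp; have := find_size (fun k => has_walk G k x (last x p)) (iota 0 #|T|).
rewrite -/(dist _ _ _) size_iota => le_dT.
case: (leqP #|T| (size p)) => [/(leq_trans le_dT) //|lt_pT].
rewrite leqNgt; apply/negP => /(before_find 0%N)/negbT/negP; apply.
rewrite nth_iota //. apply/existsP; exists (in_tuple p).
by rewrite /= xp eqxx.
Qed.

(** A walk can be shortened to a path without repeated vertices, of length less
    than #|T|; so the search range in dist is long enough. *)
Lemma dist_walk G x y : connect (adj G) x y ->
  exists p, [/\ path (adj G) x p, last x p = y & size p = dist G x y].
Proof.
case/connectP => p0 /shortenP[p xp up _] ->.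
have lt_pT : (size p < #|T|)%N.
  by have := max_card (mem (x :: p)); rewrite (card_uniqP up).
have : has (fun k => has_walk G k x (last x p)) (iota 0 #|T|).
  apply/hasP; exists (size p); first by rewrite mem_iota.
  by apply/existsP; exists (in_tuple p); rewrite /= xp eqxx.
move=> hw; have := nth_find 0%N hw; rewrite -/(dist _ _ _) nth_iota.
  by case/existsP => q /andP[xq /eqP Eq]; exists q; rewrite size_tuple.
by move: hw; rewrite has_find size_iota.
Qed.

Lemma dist0 G x : dist G x x = 0%N.
Proof. by apply/eqP; rewrite -leqn0 (@dist_le_walk _ _ [::]). Qed.

Lemma dist_triangle G x y z : connect (adj G) x y -> connect (adj G) y z ->
  (dist G x z <= dist G x y + dist G y z)%N.
Proof.
move=> /dist_walk[p [xp Ey <-]] /dist_walk[q [yq Ez <-]].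
by rewrite -size_cat -{}Ez -{}Ey in yq * ; rewrite -last_cat dist_le_walk // cat_path xp.
Qed.

Lemma dist_subgraph H G x y : subgraph H G -> connect (adj H) x y ->
  (dist G x y <= dist H x y)%N.
Proof.
move=> sHG /dist_walk[p [xp <- <-]]; apply: dist_le_walk.
exact: sub_path (adj_subgraph sHG) _ _ xp.
Qed.

Lemma connectedP G : reflect
  ((exists x, x \in vertices G) /\
   {in vertices G &, forall x y, connect (adj G) x y}) (connected G).
Proof.
apply: (iffP andP) => [[/set0Pn ? /forall_inP c]|[/set0Pn ? c]]; split => //.
  by move=> x y xG yG; apply: (forall_inP (c x xG)).
by apply/forall_inP => x xG; apply/forall_inP => y; apply: c.
Qed.

(** * Splitting a graph at a vertex *)

Definition separation G v V1 V2 : Prop :=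
  [/\ V1 :|: V2 = vertices G, V1 :&: V2 = [set v]
    & forall x y, adj G x y ->
        (x \in V1) && (y \in V1) || (x \in V2) && (y \in V2)].

Lemma separationC G v V1 V2 : separation G v V1 V2 -> separation G v V2 V1.
Proof.
case=> VU VI VE; split; rewrite ?[V2 :|: _]setUC ?[V2 :&: _]setIC //.
by move=> x y /VE; rewrite orbC.
Qed.

Lemma separation_cut G v V1 V2 : separation G v V1 V2 -> (v \in V1) && (v \in V2).
Proof. by case=> _ VI _; rewrite -in_setI VI set11. Qed.

Lemma separation_inter G v V1 V2 x :
  separation G v V1 V2 -> x \in V1 -> x \in V2 -> x = v.
Proof. by case=> _ VI _ x1 x2; apply/set1P; rewrite -VI inE x1. Qed.

Lemma separation_subl G v V1 V2 : separation G v V1 V2 -> V1 \subset vertices G.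
Proof. by case=> <- _ _; apply: subsetUl. Qed.

Definition retract A v x := if x \in A then x else v.

Section Separation.

Variables (G : graph T) (v : T) (V1 V2 : {set T}).
Hypothesis sep : separation G v V1 V2.
Let G1 := induced G V1.
Let G2 := induced G V2.

Let r1_V2 x : x \in V2 -> retract V1 v x = v.
Proof. by move=> x2; rewrite /retract; case: ifP => // x1; apply: separation_inter sep x1 x2. Qed.
Let r2_V1 x : x \in V1 -> retract V2 v x = v.
Proof. by move=> x1; rewrite /retract; case: ifP => // x2; apply: separation_inter sep x1 x2. Qed.
Let r1_V1 x : x \in V1 -> retract V1 v x = x.
Proof. by rewrite /retract => ->. Qed.
Let r2_V2 x : x \in V2 -> retract V2 v x = x.
Proof. by rewrite /retract => ->. Qed.

(** Each step of the walk lies in V1 or in V2.  The two retractions keep it in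
    the side that contains it and collapse it to v in the other side, so the
    lengths of the two resulting walks add up to the original length. *)
Lemma retract_walk x p : path (adj G) x p -> exists q1 q2,
  [/\ path (adj G1) (retract V1 v x) q1
        /\ last (retract V1 v x) q1 = retract V1 v (last x p),
      path (adj G2) (retract V2 v x) q2
        /\ last (retract V2 v x) q2 = retract V2 v (last x p)
    & (size q1 + size q2 = size p)%N].
Proof.
elim: p x => [|y p IHp] x /=; first by exists [::], [::].
case/andP => xy /IHp[q1 [q2 [[w1 l1] [w2 l2] sz]]].
case: sep => _ _ /(_ _ _ xy)/orP[]/andP[xV yV].
- exists (retract V1 v y :: q1), q2.
  rewrite /= w1 l1 induced_adj !(r1_V1 xV, r1_V1 yV) xy xV yV.
  by rewrite (r2_V1 yV) in w2 l2; rewrite (r2_V1 xV) w2 l2 addSn sz.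
- exists q1, (retract V2 v y :: q2).
  rewrite /= w2 l2 induced_adj !(r2_V2 xV, r2_V2 yV) xy xV yV.
  by rewrite (r1_V2 yV) in w1 l1; rewrite (r1_V2 xV) w1 l1 addnS sz.
Qed.

Hypothesis conG : connected G.

Lemma connected_part : connected G1.
Proof.
have [_ con] := connectedP _ conG; have /subsetP sV1 := separation_subl sep.
apply/connectedP; rewrite (induced_vertices (separation_subl sep)); split.
  by exists v; case/andP: (separation_cut sep).
move=> x y xV yV; case/connectP: (con x y (sV1 x xV) (sV1 y yV)) => p xp Ey.
have [q1 [_ [[w1 l1] _ _]]] := retract_walk xp.
rewrite -Ey !r1_V1 // in w1 l1.
by apply/connectP; exists q1.
Qed.

Lemma dist_retract : {in vertices G &, forall x y,
  (dist G1 (retract V1 v x) (retract V1 v y) +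
   dist G2 (retract V2 v x) (retract V2 v y) <= dist G x y)%N}.
Proof.
move=> x y xG yG; have [_ /(_ x y xG yG)/dist_walk[p [xp Ey <-]]] := connectedP _ conG.
have [q1 [q2 [[w1 l1] [w2 l2] <-]]] := retract_walk xp.
by apply: leq_add; rewrite -Ey -?l1 -?l2 dist_le_walk.
Qed.

(** A shortest walk between two vertices of V1 that leaves V1 is retracted to a
    walk inside V1 that is not longer. *)
Lemma dist_part : {in V1 &, forall x y, dist G x y = dist G1 x y}.
Proof.
move=> x y xV yV; have /subsetP sV1 := separation_subl sep.
apply/eqP; rewrite eqn_leq; apply/andP; split.
  apply: dist_subgraph (induced_subgraph _ _) _.
  have [_] := connectedP _ connected_part.
  by rewrite (induced_vertices (separation_subl sep)); apply.
apply: leq_trans (dist_retract (sV1 x xV) (sV1 y yV)).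
by rewrite !r1_V1 // leq_addr.
Qed.

End Separation.

Lemma dist_through G v V1 V2 x y : separation G v V1 V2 -> connected G ->
  x \in V1 -> y \in V2 -> dist G x y = (dist G x v + dist G v y)%N.
Proof.
move=> sep conG x1 y2; have sepC := separationC sep.
have [VU _ _] := sep; have [_ con] := connectedP _ conG.
have /andP[v1 v2] := separation_cut sep; have only z := @separation_inter _ _ _ _ z sep.
have xG : x \in vertices G by rewrite -VU inE x1.
have yG : y \in vertices G by rewrite -VU inE y2 orbT.
have vG : v \in vertices G by rewrite -VU inE v1.
apply/eqP; rewrite eqn_leq dist_triangle ?con //=.
rewrite (dist_part sep) // (dist_part sepC) //.
apply: leq_trans (dist_retract sep conG xG yG).
rewrite /retract x1 y2.
have -> : (if y \in V1 then y else v) = v by case: ifP => // /only->.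
by have -> : (if x \in V2 then x else v) = v by case: ifP => // /(only _ x1)->.
Qed.

(** * Blocks of the two sides *)

(** If H had vertices on both sides, then v would separate them: in H - v no
    step leaves V1 or enters it. *)
Lemma nonseparable_side G v V1 V2 H : separation G v V1 V2 ->
    subgraph H G -> nonseparable H ->
  (vertices H \subset V1) || (vertices H \subset V2).
Proof.
move=> sep sHG /andP[/connectedP[_ con] /forallP/(_ v) cut].
have [VU _ VE] := sep; have /andP[vV1 vV2] := separation_cut sep.
have only z := @separation_inter _ _ _ _ z sep.
apply: contraNT cut; rewrite negb_or.
case/andP => /subsetPn[a aH aV1] /subsetPn[b bH bV2].
have sub z : z \in vertices H -> (z \in V1) || (z \in V2).
  by case/andP: sHG => /subsetP sv _ /sv; rewrite -VU inE.
have bV1 : b \in V1 by have := sub b bH; rewrite (negPf bV2) orbF.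
have clo : closed (adj_del H v) (mem V1).
  move=> x y /and3P[xv yv /(adj_subgraph sHG)/VE].
  case/orP=> /andP[]; first by move=> ? ?; apply/idP/idP.
  move=> x2 y2; apply/idP/idP => /only E.
    by rewrite E ?eqxx in xv.
  by rewrite E ?eqxx in yv.
have noab : ~~ connect (adj_del H v) a b.
  by apply/negP => /(closed_connect clo); rewrite /= bV1 (negPf aV1).
(* Without v, the graph H - v would be H, which is connected. *)
have vH : v \in vertices H.
  apply: contraR noab => vH; rewrite (@eq_connect _ _ (adj H)) ?con // => x y.
  rewrite /adj_del; apply/idP/idP => [/and3P[] //|xy].
  case/andP: (adj_vertices xy) => xH yH; rewrite xy andbT.
  by apply/andP; split; apply: contraNneq vH => <-.
rewrite /cut_vertex vH; apply/exists_inP; exists a.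
  by rewrite !inE aH andbT; apply: contraNneq aV1 => ->.
apply/exists_inP; exists b; last by rewrite con.
by rewrite !inE bH andbT; apply: contraNneq bV2 => ->.
Qed.

(** One side consists of a cut-vertex v and a component of G - v, the other one
    of all vertices outside this component. *)
Lemma exists_separation G : connected G -> ~~ nonseparable G ->
  exists v V1 V2, [/\ separation G v V1 V2, (1 < #|V1|)%N, (1 < #|V2|)%N,
    V1 \proper vertices G & V2 \proper vertices G].
Proof.
move=> conG; rewrite /nonseparable conG negb_forall /= => /existsP[v].
rewrite negbK => /andP[vG /exists_inP[x]]; rewrite !inE => /andP[xv xG].
case/exists_inP=> y; rewrite !inE => /andP[yv yG] /andP[_ noxy].
pose C := [set z in vertices G | (z != v) && connect (adj_del G v) x z].
have xC : x \in C by rewrite !inE xG xv connect0.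
have yC : y \notin C by rewrite !inE yG yv.
have vC : v \notin C by rewrite !inE eqxx andbF.
have sC : C \subset vertices G by apply/subsetP => z; rewrite inE => /andP[].
exists v, (v |: C), (vertices G :\: C); split.
- split.
  + apply/setP => z; rewrite in_setU in_setU1 in_setD; case: eqP => [->|_] //=.
    by have [/(subsetP sC) ->|] := boolP (z \in C).
  + apply/setP => z; rewrite in_setI in_setU1 in_setD in_set1; case: eqP => [->|_] /=.
      by rewrite vC vG.
    by rewrite andbA andbN.
  + move=> a b ab; have /andP[aG bG] := adj_vertices ab.
    have step c d : adj G c d -> c \in C -> d \in v |: C.
      move=> cd; rewrite !inE => /and3P[cG cv xc].
      have /andP[_ ->] := adj_vertices cd; case: eqP => //= /eqP dv.
      by apply: connect_trans xc (connect1 _); rewrite /adj_del cv dv.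
    have [aC|aC] := boolP (a \in C).
      by rewrite (step _ _ ab aC) setU1r.
    have [bC|bC] := boolP (b \in C).
      by rewrite adjC in ab; rewrite (step _ _ ab bC) setU1r.
    by rewrite !in_setD aC bC aG bG orbT.
- by rewrite cardsU1 vC add1n ltnS card_gt0; apply/set0Pn; exists x.
- by rewrite (cardsD1 v) (cardsD1 y) in_setD1 !in_setD vC vG yv yG yC.
- rewrite properE subUset sub1set vG sC; apply/subsetPn; exists y => //.
  by rewrite in_setU1 negb_or yv.
- rewrite properE subsetDl; apply/subsetPn; exists x => //.
  by rewrite in_setD xC.
Qed.

Fact edge_graph_proof G e : e \in edges G -> is_graph (e, [set e]).
Proof.
by move=> eG; apply/forall_inP => _ /set1P ->; rewrite (edge_card eG) eqxx subxx.
Qed.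

Lemma edge_nonseparable G e (eG : e \in edges G) :
  nonseparable (Graph (edge_graph_proof eG)).
Proof.
set K := Graph _; have e2 := edge_card eG; apply/andP; split.
  apply/connectedP; split.
    by apply/set0Pn; rewrite -card_gt0 [#|_|]e2.
  move=> x y xe ye; have [->|xy] := eqVneq x y; first exact: connect0.
  apply: connect1; rewrite /adj /edges inE /= eqEcard cards2 xy e2 andbT.
  by rewrite subUset !sub1set; apply/andP.
apply/forallP => w; apply/negP => /andP[we /exists_inP[x xe] /exists_inP[y ye]].
suff -> : x = y by rewrite !connect0 andbF.
have : #|e :\ w| = 1 by move: e2; rewrite (cardsD1 w) [w \in e]we => -[].
by case/eqP/cards1P => z ez; move: xe ye; rewrite /vertices /= ez => /set1P-> /set1P.
Qed.

(** A block with a single vertex would be contained in the nonseparable graph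
    formed by any edge at that vertex.  This is what prevents the cut-vertex
    from being a block of one of the sides, or a block of both. *)
Lemma block_card_gt1 G B : connected G -> (1 < #|vertices G|)%N -> B \in blocks G ->
  (1 < #|vertices B|)%N.
Proof.
move=> /connectedP[_ con] G1; rewrite inE => /and3P[sBG nB /forallP maxB].
rewrite ltnNge; apply/negP => B1.
have [[w wB] _] := connectedP _ (proj1 (andP nB)).
have Bw : vertices B = [set w].
  by apply/esym/eqP; rewrite eqEcard sub1set wB cards1.
have noE e : e \notin edges B.
  apply/negP => eB; have := subset_leq_card (edge_sub eB).
  by rewrite Bw cards1 (edge_card eB).
have wG : w \in vertices G by case/andP: sBG => /subsetP ->.
have [u uG uw] : exists2 u, u \in vertices G & u != w.
  move: G1; rewrite (cardsD1 w) wG ltnS card_gt0 => /set0Pn[u].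
  by rewrite !inE => /andP[]; exists u.
case/connectP: (con w u wG uG) => -[/= _ E|z p /= /andP[wz _] _].
  by rewrite E eqxx in uw.
pose K := Graph (edge_graph_proof wz).
suff /(implyP (maxB K))/eqP EK : [&& subgraph K G, nonseparable K & subgraph B K].
  by move: B1; rewrite -EK [#|_|](edge_card wz).
rewrite edge_nonseparable /subgraph /vertices /edges /= -/(vertices G) -/(edges G).
rewrite sub1set [_ \in edges G]wz edge_sub //= -/(vertices B) Bw sub1set !inE eqxx.
by apply/subsetP => e eB; have := noE e; rewrite eB.
Qed.

Lemma is_blockP G B : reflect
  [/\ subgraph B G, nonseparable B
    & forall H, subgraph H G -> nonseparable H -> subgraph B H -> H = B]
  (B \in blocks G).
Proof.
rewrite inE; apply: (iffP and3P) => -[sBG nB maxB]; split=> //.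
  by move=> H ? ? ?; apply/eqP; apply: (implyP (forallP maxB H)); apply/and3P.
by apply/forallP => H; apply/implyP => /and3P[? ? ?]; apply/eqP/maxB.
Qed.

Lemma blocks_nonseparable G : nonseparable G -> blocks G = [set G].
Proof.
move=> nG; apply/setP => B; rewrite in_set1; apply/is_blockP/eqP => [[sBG nB maxB]|->].
  by rewrite (maxB G) ?subgraph_refl.
split=> // [|H sHG _ sGH]; first exact: subgraph_refl.
by apply: subgraph_anti; rewrite sHG.
Qed.

(** A nonseparable subgraph of G that contains B lies in one side.  If this is
    not V1, then B has no other vertex than v, which is impossible. *)
Lemma block_part G v V1 V2 B : separation G v V1 V2 -> connected G ->
  (1 < #|V1|)%N -> B \in blocks (induced G V1) -> B \in blocks G.
Proof.
move=> sep conG c1 BB; have s1 := induced_subgraph G V1.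
have sV1 := separation_subl sep; have [_ VI _] := sep.
have B1 : (1 < #|vertices B|)%N.
  apply: block_card_gt1 BB; rewrite ?induced_vertices //.
  exact: connected_part sep conG.
have [sB nB maxB] := is_blockP _ _ BB.
apply/is_blockP; split=> // [|H sHG nH sBH]; first exact: subgraph_trans sB s1.
case/orP: (nonseparable_side sep sHG nH) => sHV.
  by apply: maxB => //; apply: subgraph_induced.
suff : vertices B \subset [set v].
  by move/subset_leq_card; rewrite cards1 leqNgt B1.
rewrite -VI subsetI; case/andP: sB; rewrite induced_vertices // => -> _ /=.
by case/andP: sBH => /subset_trans ->.
Qed.

Lemma block_side G v V1 V2 B : separation G v V1 V2 -> B \in blocks G ->
  vertices B \subset V1 -> B \in blocks (induced G V1).
Proof.
move=> sep /is_blockP[sB nB maxB] sBV; apply/is_blockP; split=> //.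
  exact: subgraph_induced.
by move=> H sH nH sBH; apply: maxB => //; apply: subgraph_trans sH (induced_subgraph _ _).
Qed.

Lemma blocks_separation G v V1 V2 : separation G v V1 V2 -> connected G ->
  (1 < #|V1|)%N -> (1 < #|V2|)%N ->
  blocks G = blocks (induced G V1) :|: blocks (induced G V2)
  /\ [disjoint blocks (induced G V1) & blocks (induced G V2)].
Proof.
move=> sep conG c1 c2; have sepC := separationC sep; split.
  apply/setP => B; rewrite [RHS]inE; apply/idP/orP => [BB|[]].
  - have [sB nB _] := is_blockP _ _ BB.
    case/orP: (nonseparable_side sep sB nB) => sBV; [left|right].
      exact: block_side sep BB sBV.
    exact: block_side sepC BB sBV.
  - exact: block_part sep conG c1.
  - exact: block_part sepC conG c2.
rewrite -setI_eq0; apply/eqP/setP => B; rewrite !inE -!/(is_block _ _).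
apply/negP => /andP[b1 b2].
have B1 : (1 < #|vertices B|)%N.
  apply: (@block_card_gt1 (induced G V1)); rewrite ?inE ?induced_vertices ?(separation_subl sep) //.
  exact: connected_part sep conG.
have [_ VI _] := sep.
suff : vertices B \subset [set v].
  by move/subset_leq_card; rewrite cards1 leqNgt B1.
case/and3P: b1 => /andP[s1 _] _ _; case/and3P: b2 => /andP[s2 _] _ _.
rewrite -VI subsetI.
by rewrite !induced_vertices ?(separation_subl sep) ?(separation_subl sepC) // in s1 s2; rewrite s1.
Qed.

End Graphs.

(** * The determinant and the cofactor sum of a distance matrix *)

Lemma big_setU_disjoint (R : Type) (idx : R) (op : Monoid.com_law idx)
    (I : finType) (A B : {set I}) (F : I -> R) : [disjoint A & B] ->
  \big[op/idx]_(i in A :|: B) F i =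
  op (\big[op/idx]_(i in A) F i) (\big[op/idx]_(i in B) F i).
Proof. by move=> dAB; rewrite -bigU //; apply: eq_bigl => i; rewrite !inE. Qed.

Section DistanceDeterminant.

Variable T : finType.
Implicit Types (G B : graph T).

(** Both sides of a separation of a separable graph are proper subsets of the
    vertices, so that the induction is on the number of vertices. *)
Lemma connected_block_ind (P : graph T -> Prop) :
    (forall G, nonseparable G -> P G) ->
    (forall G v V1 V2, separation G v V1 V2 -> connected G ->
       (1 < #|V1|)%N -> (1 < #|V2|)%N ->
       P (induced G V1) -> P (induced G V2) -> P G) ->
  forall G, connected G -> P G.
Proof.
move=> P_ns P_sep G; have [n] := ubnP #|vertices G|.
elim: n G => // n IHn G leVn conG.
have [nsG|sepG] := boolP (nonseparable G); first exact: P_ns.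
have [v [V1 [V2 [sep c1 c2 p1 p2]]]] := exists_separation conG sepG.
have sepC := separationC sep.
have small (A : {set T}) : A \proper vertices G -> (#|vertices (induced G A)| < n)%N.
  move=> pA; rewrite induced_vertices ?proper_sub //.
  by apply: leq_trans (proper_card pA) _; rewrite -ltnS.
apply: (P_sep _ _ _ _ sep) => //; apply: IHn (small _ _) _ => //.
  exact: connected_part sep conG.
exact: connected_part sepC conG.
Qed.

Let d G x y : rat := (dist G x y)%:R.

Lemma dist_mx_part G v V1 V2 : separation G v V1 V2 -> connected G ->
  \det (dist_mx (induced G V1)) = set_det V1 (d G)
  /\ cof (dist_mx (induced G V1)) = set_cof V1 (d G).
Proof.
move=> sep conG; pose G1 := induced G V1.
have -> : dist_mx G1 = gram (vertices G1) (vertices G1) (d G).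
  have inV1 x : x \in vertices G1 -> x \in V1.
    by rewrite (induced_vertices (separation_subl sep)).
  by apply/matrixP => i j; rewrite !mxE /d (dist_part sep conG) ?inV1 ?enum_valP.
by rewrite -/(set_det _ _) -/(set_cof _ _) (induced_vertices (separation_subl sep)).
Qed.

Lemma dist_mx_separation G v V1 V2 : separation G v V1 V2 -> connected G ->
  let D1 := dist_mx (induced G V1) in let D2 := dist_mx (induced G V2) in
  cof (dist_mx G) = cof D1 * cof D2
  /\ \det (dist_mx G) = \det D1 * cof D2 + cof D1 * \det D2.
Proof.
move=> sep conG D1 D2; have sepC := separationC sep.
have [-> ->] := dist_mx_part sep conG.
have [-> ->] := dist_mx_part sepC conG.
have [VU VI _] := sep.
rewrite -[cof _]/(set_cof (vertices G) (d G)).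
rewrite -[\det _]/(set_det (vertices G) (d G)) -VU.
apply: set_det_glue VI _ _ _ => [|x y xV yV|x y xV yV]; first by rewrite /d dist0.
- by rewrite /d -natrD (dist_through sep conG xV yV).
- by rewrite /d -natrD (dist_through sepC conG xV yV).
Qed.

Theorem cof_dist_mx_blocks G : connected G ->
  cof (dist_mx G) = \prod_(B in blocks G) cof (dist_mx B).
Proof.
move: G; apply: connected_block_ind => [G nsG|G v V1 V2 sep conG c1 c2 IH1 IH2].
  by rewrite blocks_nonseparable // big_set1.
have [-> _] := dist_mx_separation sep conG.
have [-> dis] := blocks_separation sep conG c1 c2.
by rewrite IH1 IH2 big_setU_disjoint.
Qed.

Theorem det_dist_mx_blocks G : connected G ->
    (forall B, B \in blocks G -> cof (dist_mx B) != 0) ->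
  \det (dist_mx G) = lambda_graph G * \prod_(B in blocks G) cof (dist_mx B).
Proof.
move: G; apply: connected_block_ind => [G nsG|G v V1 V2 sep conG c1 c2 IH1 IH2] hcof.
  rewrite /lambda_graph blocks_nonseparable // !big_set1 divfK // hcof //.
  by rewrite blocks_nonseparable // set11.
have [_ ->] := dist_mx_separation sep conG.
have sepC := separationC sep.
have [EB dis] := blocks_separation sep conG c1 c2.
rewrite IH1 ?IH2 => [|B BV|B BV]; last 2 first.
- by apply: hcof; rewrite EB inE BV orbT.
- by apply: hcof; rewrite EB inE BV.
rewrite !cof_dist_mx_blocks; last 2 first.
- exact: connected_part sep conG.
- exact: connected_part sepC conG.
rewrite /lambda_graph EB !big_setU_disjoint //=; ring.
Qed.

End DistanceDeterminant.

Theorem theorem4p5 (T : finType) (G : graph T) (hG : multi_block G)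
  (hcof : forall B : graph T, B \in blocks G -> cof (dist_mx B) != 0) :
  \det (dist_mx G) = lambda_graph G * \prod_(B in blocks G) cof (dist_mx B) /\
  lambda_graph G * \prod_(B in blocks G) cof (dist_mx B) =
    lambda_graph G * cof (dist_mx G).
Proof.
have [conG _] := hG; split; first exact: det_dist_mx_blocks.
by rewrite cof_dist_mx_blocks.
Qed.
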